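(* Consider the online ranking game with top-1 feedback where an oblivious adversary chooses $r_1,\dots,r_T\in\{0,1,\dots,n\}^m$. Let the learner run algorithm RTop-1F (described in the context, with relevance values transformed by $g(x)=2^x-1$) with $K=m^{-1/3}T^{2/3}$ and $\epsilon=\sqrt{1/((2^n-1)^2mK)}$. Then $$\mathbb{E}\Big[\sum_{t=1}^T DCG(\sigma_t,r_t)\Big]\ge\max_\sigma\sum_{t=1}^T DCG(\sigma,r_t)-O\big((2^n-1)m^{5/3}T^{2/3}\big),$$ the expectation being over the learner's random actions. In the binary case ($n=1$) the regret term is $O(m^{5/3}T^{2/3})$. Moreover, since local observability fails for DCG with top-1 feedback, there is a matching lower bound: for $m=3$ and binary relevance, for every learner algorithm there is an adversary for which the expected regret is $\Omega(T^{2/3})$.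
   Context: Objects are $\{1,\dots,m\}$; a ranking is a permutation $\sigma$ of $[m]$ with $\sigma(i)$ the rank of object $i$ and $\sigma^{-1}(j)$ the object at rank $j$. $DCG(\sigma,r)=\sum_{i=1}^m\frac{2^{r(i)}-1}{\log_2(1+\sigma(i))}$ (a gain). Regret is $\max_\sigma\sum_t DCG(\sigma,r_t)-\mathbb{E}\sum_tDCG(\sigma_t,r_t)$. Game: the oblivious adversary fixes $r_1,\dots,r_T$ in advance; at round $t$ the learner outputs $\sigma_t$ and observes only $r_t(\sigma_t^{-1}(1))$. Algorithm RTop-1F with parameters $K,\epsilon$: split $\{1,\dots,T\}$ into $K$ consecutive blocks $B_i=\{(i-1)T/K+1,\dots,iT/K\}$. Initialize $\hat s_0=\hat r_0=0\in\mathbb{R}^m$. For $i=1,\dots,K$: set $\hat s_i=\hat s_{i-1}+\hat r_{i-1}$; choose $m$ distinct time points $i_1,\dots,i_m$ from $B_i$ uniformly at random without replacement; for each $t\in B_i$: if $t=i_j$, output any permutation placing object $j$ at rank 1 and receive $r_{i_j}(j)$; otherwise sample $p_t$ uniformly from $[0,1/\epsilon]^m$ and output $\sigma_t=\arg\min_\sigma\sigma\cdot(\hat s_i+p_t)$ (here $\sigma$ is identified with $(\sigma(1),\dots,\sigma(m))$). At the end of the block set $\hat r_i=(2^{r_{i_1}(1)}-1,\dots,2^{r_{i_m}(m)}-1)$.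
   Formalization: The upper bound is proved for those m, T for which the algorithm is defined as written: K = m^{-1/3}T^{2/3} is a positive integer dividing T and each block has T/K ≥ m rounds (also m, n ≥ 1); no rounding of K is considered. *)

(* Defs.v *)
From HB Require Import structures.
From mathcomp Require Import all_boot all_order all_algebra all_fingroup.
From mathcomp Require Import all_classical all_reals all_analysis.
Set Implicit Arguments. Unset Strict Implicit. Unset Printing Implicit Defensive.
Import Order.TTheory GRing.Theory Num.Theory.
Import numFieldNormedType.Exports.
Local Open Scope classical_set_scope.
Local Open Scope ring_scope.

Section Ranking.
Variable R : realType.

(* Objects and ranks are 'I_m (0-based): sigma i = rank of object i minus 1,
   so the paper's rank sigma(i) is (sigma i).+1 and 1 + sigma(i) is (sigma i).+2. *)
Definition log2 (x : R) : R := ln x / ln 2.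

Definition DCG (m : nat) (s : 'S_m) (r : 'I_m -> nat) : R :=
  \sum_(i < m) ((2 : R) ^+ r i - 1) / log2 (((s i).+2)%:R).

Definition cumDCG (m T : nat) (r : nat -> 'I_m -> nat) (s : 'S_m) : R :=
  \sum_(t < T) DCG s (r t).

Definition best_cumDCG (m T : nat) (r : nat -> 'I_m -> nat) : R :=
  \big[Num.max/cumDCG T r 1%g]_(s : 'S_m) cumDCG T r s.

Definition score (m : nat) (s : 'S_m) (v : 'I_m -> R) : R :=
  \sum_(i < m) ((s i).+1)%:R * v i.

(* argmin_sigma sigma . v  (ties, a null event for the perturbed scores,
   broken by [pick]) *)
Definition argmin_perm (m : nat) (v : 'I_m -> R) : 'S_m :=
  odflt 1%g [pick s : 'S_m | [forall s' : 'S_m, score s v <= score s' v]].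

(* box_avg a k f = average of f(p) over p uniform in [0,a]^k, where
   p : nat -> R uses coordinates 0..k-1 (iterated integral against Lebesgue
   measure, i.e. the expectation w.r.t. the uniform law on the box). *)
Fixpoint box_avg (a : R) (k : nat) (f : (nat -> R) -> R) : R :=
  match k with
  | 0 => f (fun _ => 0)
  | k'.+1 => a^-1 * Rintegral (@lebesgue_measure R) `[0, a]
                 (fun x => box_avg a k' (fun p => f (fun j => if j == k' then x else p j)))
  end.

Definition fpl_gain (m : nat) (eps : R) (shat : 'I_m -> R) (rt : 'I_m -> nat) : R :=
  box_avg eps^-1 m (fun p => DCG (argmin_perm (fun i => shat i + p i)) rt).

(* ---- Algorithm RTop-1F ----
   Rounds t = 0..T-1, K blocks of length L = T %/ K; block i (0-based) is
   {i*L, ..., i*L + L - 1}.  The exploration choice of block i is an injective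
   map e : 'I_m -> 'I_L, e j = offset in the block of the time point i_j. *)
Definition expl_choice (m K L : nat) := {ffun 'I_K -> {ffun 'I_m -> 'I_L}}.

Definition valid_choice (m K L : nat) (E : expl_choice m K L) : bool :=
  [forall i, injectiveb (E i)].

Definition shat (m K L : nat) (r : nat -> 'I_m -> nat) (E : expl_choice m K L)
  (i : 'I_K) (j : 'I_m) : R :=
  \sum_(i' < K | (i' < i)%N) ((2 : R) ^+ r (i' * L + E i' j)%N j - 1).

(* expected (over p_t) gain of round t = i*L + o given the exploration
   choices E; expl t j is the permutation output at exploration time t = i_j. *)
Definition round_gain (m K L : nat) (eps : R) (r : nat -> 'I_m -> nat)
  (expl : nat -> 'I_m -> 'S_m) (E : expl_choice m K L) (i : 'I_K) (o : 'I_L) : R :=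
  let t := (i * L + o)%N in
  match [pick j | E i j == o] with
  | Some j => DCG (expl t j) (r t)
  | None => fpl_gain eps (shat r E i) (r t)
  end.

(* E[ sum_{t=1}^T DCG(sigma_t, r_t) ] for RTop-1F with parameters K, eps:
   exploration choices of the K blocks independent and uniform over injective
   maps (m distinct points drawn without replacement), perturbations p_t
   independent uniform on [0,1/eps]^m. *)
Definition rtop1f_expected_gain (m T K : nat) (eps : R) (r : nat -> 'I_m -> nat)
  (expl : nat -> 'I_m -> 'S_m) : R :=
  let L := (T %/ K)%N in
  (\sum_(E : expl_choice m K L | valid_choice E)
      \sum_(i < K) \sum_(o < L) round_gain eps r expl E i o)
  / (#|[set E : expl_choice m K L | valid_choice E]|)%:R.

(* ---- General learners with top-1 feedback (for the lower bound) ----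
   A (randomized) learner is given in behavioural form: after the history
   h = [:: (sigma_1, fb_1); ...; (sigma_{t-1}, fb_{t-1})] of its own actions and
   observed feedbacks it plays sigma with probability L h sigma. *)
Definition learner (m : nat) := seq ('S_m * nat) -> 'S_m -> R.

Definition is_learner (m : nat) (L : learner m) : Prop :=
  forall h, (forall s, 0 <= L h s) /\ \sum_(s : 'S_m) L h s = 1.

Definition top1_feedback (m : nat) (s : 'S_m) (rt : 'I_m -> nat) (x0 : 'I_m) : nat :=
  rt ((s^-1)%g x0).

Fixpoint learner_value (m : nat) (L : learner m) (r : nat -> 'I_m -> nat)
  (k t : nat) (h : seq ('S_m * nat)) : R :=
  match k with
  | 0 => 0
  | k'.+1 =>
    \sum_(s : 'S_m) L h s *
      (DCG s (r t) + learner_value L r k' t.+1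
          (rcons h (s, match m as m0 return ('S_m0 -> ('I_m0 -> nat) -> nat) with
                       | 0 => fun _ _ => 0%N
                       | m'.+1 => fun s rt => top1_feedback s rt ord0
                       end s (r t))))
  end.

Definition learner_expected_gain (m T : nat) (L : learner m) (r : nat -> 'I_m -> nat) : R :=
  learner_value L r T 0 [::].

End Ranking.

(* Main.v *)
Require Import Defs.
From HB Require Import structures.
From mathcomp Require Import all_boot all_order all_algebra all_fingroup.
From mathcomp Require Import all_classical all_reals all_analysis.
From mathcomp Require Import measurable_realfun ring lra.
Set Implicit Arguments. Unset Strict Implicit. Unset Printing Implicit Defensive.
Import Order.TTheory GRing.Theory Num.Theory.
Import numFieldNormedType.Exports.
Local Open Scope classical_set_scope.
Local Open Scope ring_scope.

(** Upper bound.  By the rearrangement inequality the permutation minimising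
    [sigma . v] maximises the DCG-weighted sum of [v], so playing it against the
    perturbed cumulative estimates is follow-the-perturbed-leader.  Over the [K]
    estimated vectors, be-the-leader costs at most [m / eps] (the size of the
    perturbation), and replacing the next leader by the current one costs at most
    [eps (m B)^2] per block, [B = 2^n - 1], because translating the box
    [[0, 1/eps]^m] by the new estimate moves little mass.  The estimates are
    unbiased given the past, so multiplying by the block length turns this into
    regret on the true sequence; the [m K] exploration rounds cost [m B] each.
    With [a = m^(1/3)] and [b = T^(1/3)] one has [K = b^2 / a], [L = a b] and
    [1/eps = B a b], and each of the three terms equals [B a^5 b^2].

    Lower bound.  Object 0 is always relevant and exactly one of objects 1, 2 is,
    according to a hidden coin of bias [1/2 + e] or [1/2 - e].  Ranking object 0
    first shows nothing, any other ranking loses a constant.  If [a], [b] are the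
    likelihoods of the history under the two biases, the remaining regret weighted
    by [a] and [b] is at least [2 e d k ab/(a+b)] for [k] remaining rounds, where
    [d] is the gap between the second and third weights; this is an induction on
    [k] as long as [k e^3] is small, and [e ~ T^(-1/3)] gives [T^(2/3)]. *)

(** * Translation of Lebesgue integrals *)

Section LebesgueTranslation.
Context {R : realType}.
Local Notation mu := (@lebesgue_measure R).

(** By uniqueness of Lebesgue measure: the pushforward has the same values on half-open
    intervals. *)
Lemma lebesgue_measure_translate (d : R) (A : set R) : measurable A ->
  pushforward mu ((fun x => x + d) : _ -> measurableTypeR R) A = mu A.
Proof.
move=> mA; apply/esym/lebesgue_measure_unique => //=.
  exact: measurable_funD.
move=> mt _ [[a b]] _ <-.
rewrite /pushforward.
have -> : (fun x : R => x + d) @^-1` `]a, b] = `]a - d, b - d]%classic.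
  apply/seteqP; split => x /=; rewrite !in_itv/= ltrBlDr lerBrDr //.
rewrite !lebesgue_measure_itv/= !lte_fin ltrD2r.
by case: ifP => // _; rewrite -!EFinB; congr EFin; ring.
Qed.

Lemma Rintegral_translate (f : R -> R) (a b d : R) :
  measurable_fun setT f -> (forall x, 0 <= f x) ->
  Rintegral mu `[a, b] (fun x => f (x + d)) = Rintegral mu `[a + d, b + d] f.
Proof.
move=> mf f0; rewrite /Rintegral; congr fine.
have mt : measurable_fun setT ((fun x => x + d) : R -> measurableTypeR R).
  exact: measurable_funD.
have -> : `[a, b]%classic =
    ((fun x => x + d) : _ -> measurableTypeR R) @^-1` `[a + d, b + d].
  by apply/seteqP; split => x /=; rewrite !in_itv/= !lerD2r.
transitivity (\int[pushforward mu ((fun x => (x + d)%R) : _ -> measurableTypeR R)]_(y in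
    `[(a + d)%R, (b + d)%R]) (EFin \o f) y)%E.
  rewrite ge0_integral_pushforward//=; last by move=> x _; rewrite lee_fin.
  exact/measurable_EFinP/measurable_funTS.
by apply: eq_measure_integral => //= A mA _; exact: lebesgue_measure_translate.
Qed.

Lemma bounded_integrable_itv (f : R -> R) (a b B : R) :
  measurable_fun setT f -> (forall x, 0 <= f x <= B) ->
  mu.-integrable `[a, b] (EFin \o f).
Proof.
move=> mf fB; apply: measurable_bounded_integrable => //.
- by rewrite /= lebesgue_measure_itv/=; case: ifP => _; rewrite ?ltry.
- exact: measurable_funTS.
- exists B; split; first by rewrite num_real.
  move=> M BM x _ /=; have /andP[f0 fb] := fB x.
  by rewrite ger0_norm// (le_trans fb) ?ltW.
Qed.

Lemma fine_lebesgue_itv (a b : R) : a <= b -> fine (mu `[a, b]) = b - a.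
Proof.
move=> ab; rewrite lebesgue_measure_itv/= lte_fin; case: ltP => // ba.
by rewrite (le_anti (introT andP (conj ab ba))) subrr.
Qed.

(* Translating the window of integration by [d] only gains the strip of
   length [d] to its right. *)
Lemma Rintegral_translate_le (f : R -> R) (a d B : R) : 0 <= a -> 0 <= d ->
  measurable_fun setT f -> (forall x, 0 <= f x <= B) ->
  Rintegral mu `[0, a] (fun x => f (x + d)) <= Rintegral mu `[0, a] f + d * B.
Proof.
move=> a0 d0 mf fB.
have f0 x : 0 <= f x by case/andP: (fB x).
rewrite Rintegral_translate//.
have int p q : mu.-integrable `[p, q] (EFin \o f) by exact: bounded_integrable_itv fB.
have mI (i : interval R) : measurable [set` i] by exact: measurable_itv.
(* As [f] is nonnegative, the moved window may be enlarged to all of [[0, a + d]], cut at [a]. *)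
apply: (@le_trans _ _ (Rintegral mu (`[0, a] `|` `]a, a + d]) f)).
  apply: fine_le.
  - exact: integrable_fin_num.
  - apply: integrable_fin_num => //; first exact: measurableU.
    apply: integrableS (int 0 (a + d)) => //; first exact: measurableU.
    move=> x /=; rewrite !in_itv/=; lra.
  apply: ge0_subset_integral => //; first exact: measurableU.
  - exact/measurable_EFinP/measurable_funTS.
  - by move=> x _; rewrite lee_fin.
  - by move=> x /=; rewrite !in_itv/=; case: (leP x a) => ?; [left|right]; lra.
rewrite Rintegral_setU//; last 2 first.
- apply: integrableS (int 0 (a + d)) => //; first exact: measurableU.
  by move=> x /=; rewrite !in_itv/=; lra.
- apply/disj_setPS => x /= []; rewrite !in_itv/=; lra.
rewrite lerD2l.
apply: (@le_trans _ _ (Rintegral mu `]a, a + d] (fun => B))).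
  apply: le_Rintegral => //.
  - apply: integrableS (int a (a + d)) => //.
    by move=> x /=; rewrite !in_itv/=; lra.
  - apply: (@integrableS _ _ _ mu `[a, a + d]) => //.
      by move=> x /=; rewrite !in_itv/=; lra.
    apply: (@bounded_integrable_itv _ _ _ B) => // x.
    by rewrite lexx andbT (le_trans (f0 0))//; case/andP: (fB 0).
  - by move=> x _; case/andP: (fB x).
rewrite Rintegral_cst//= lebesgue_measure_itv/= lte_fin; case: ifP => _ /=.
  by rewrite mulrC le_eqVlt; apply/orP; left; apply/eqP; ring.
by rewrite mulr0 mulr_ge0// (le_trans (f0 0))//; case/andP: (fB 0).
Qed.

End LebesgueTranslation.

(** * Averages over a box *)

Section BoxAverage.
Context {R : realType}.
Local Notation mu := (@lebesgue_measure R).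
Implicit Types (F G H : (nat -> R) -> R) (q : nat -> R).

Definition upd (k : nat) (x : R) q : nat -> R :=
  fun j => if j == k then x else q j.

(* The product sigma-algebra on [nat -> R] is replaced by its universal
   property: [F] is measurable along every family of measurable coordinates. *)
Definition coord_measurable F : Prop :=
  forall (d : measure_display) (Y : measurableType d) (c : Y -> nat -> R),
    (forall j, measurable_fun setT (fun y => c y j)) ->
    measurable_fun setT (fun y => F (c y)).

(** Measurable and bounded, hence integrable along every coordinate line; [B] is also the price per
    unit of translation. *)
Definition nice (B : R) F : Prop :=
  coord_measurable F /\ forall q, 0 <= F q <= B.

Lemma nice_cst (B x : R) : 0 <= x <= B -> nice B (fun=> x).
Proof. by move=> xB; split. Qed.

Lemma niceD (B1 B2 : R) F G : nice B1 F -> nice B2 G ->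
  nice (B1 + B2) (fun q => F q + G q).
Proof.
move=> [mF bF] [mG bG]; split=> [d Y c mc|q].
  by apply: measurable_funD; [exact: mF | exact: mG].
by have := bF q; have := bG q; lra.
Qed.

Lemma niceZ (B x : R) F : 0 <= x -> nice B F -> nice (x * B) (fun q => x * F q).
Proof.
move=> x0 [mF bF]; split=> [d Y c mc|q].
  by apply: measurable_funM => //; exact: mF.
by have /andP[F0 FB] := bF q; rewrite mulr_ge0//= ler_wpM2l.
Qed.

Lemma nice_sum (I : Type) (s : seq I) (B : R) (F : I -> (nat -> R) -> R) :
  (forall i, nice B (F i)) -> nice (\sum_(i <- s) B) (fun q => \sum_(i <- s) F i q).
Proof.
move=> nF; elim: s => [|i s IH].
  rewrite big_nil; under [fun q => _]eq_fun do rewrite big_nil.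
  by apply: nice_cst; rewrite lexx.
rewrite big_cons; under [fun q => _]eq_fun do rewrite big_cons.
exact: niceD.
Qed.

Lemma nice_upd (B : R) k F q : nice B F ->
  measurable_fun setT (fun x => F (upd k x q)) /\ forall x, 0 <= F (upd k x q) <= B.
Proof.
move=> [mF bF]; split=> [|x]; last exact: bF.
by apply: mF => j; rewrite /upd; case: (j == k).
Qed.

Lemma nice_integrable (B a : R) k F q : nice B F ->
  mu.-integrable `[0, a] (EFin \o (fun x => F (upd k x q))).
Proof. by move=> /(nice_upd k q)[mF bF]; exact: bounded_integrable_itv bF. Qed.

Variable a : R.
Hypothesis a0 : 0 < a.

Definition coord_avg (k : nat) F q : R :=
  a^-1 * Rintegral mu `[0, a] (fun x => F (upd k x q)).

Lemma coord_avg_le (B1 B2 : R) k F G q : nice B1 F -> nice B2 G ->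
  (forall x, 0 <= x <= a -> F (upd k x q) <= G (upd k x q)) ->
  coord_avg k F q <= coord_avg k G q.
Proof.
move=> nF nG FG; rewrite /coord_avg ler_pM2l ?invr_gt0//.
have [iF iG] := (nice_integrable a k q nF, nice_integrable a k q nG).
by apply: le_Rintegral => // x /=; rewrite in_itv; exact: FG.
Qed.

Lemma coord_avg_cst k (x : R) q : coord_avg k (fun=> x) q = x.
Proof.
rewrite /coord_avg Rintegral_cst//= fine_lebesgue_itv ?ltW// subr0 mulrCA.
by rewrite mulVf ?gt_eqF// mulr1.
Qed.

Lemma coord_avgD (B1 B2 : R) k F G q : nice B1 F -> nice B2 G ->
  coord_avg k (fun q => F q + G q) q = coord_avg k F q + coord_avg k G q.
Proof.
move=> nF nG; rewrite /coord_avg RintegralD ?mulrDr//.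
  exact: nice_integrable nF.
exact: nice_integrable nG.
Qed.

Lemma coord_avgZ (B x : R) k F q : nice B F ->
  coord_avg k (fun q => x * F q) q = x * coord_avg k F q.
Proof.
move=> nF; rewrite /coord_avg RintegralZl//; first by rewrite mulrCA.
exact: nice_integrable nF.
Qed.

Lemma nice_coord_avg (B : R) k F : nice B F -> nice B (coord_avg k F).
Proof.
move=> nF; have [mF bF] := nF; split=> [d Y c mc|q]; last first.
  have B0 : 0 <= B by have := bF (fun=> 0); lra.
  have n0 : nice B (fun=> 0) by apply: nice_cst; rewrite lexx.
  have nB : nice B (fun=> B) by apply: nice_cst; rewrite lexx B0.
  rewrite -[X in X <= _ <= _](coord_avg_cst k 0 q).
  rewrite -[X in _ <= _ <= X](coord_avg_cst k B q).
  apply/andP; split.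
    by apply: coord_avg_le n0 nF _ => x _; case/andP: (bF (upd k x q)).
  by apply: coord_avg_le nF nB _ => x _; case/andP: (bF (upd k x q)).
rewrite /coord_avg; apply: measurable_funM => //.
apply: measurableT_comp; first exact: fine_measurable.
(* With the window moved into the integrand as an indicator, the average is a Tonelli marginal over
   the whole line, hence measurable. *)
pose h (z : Y * measurableTypeR R) : \bar R :=
  (F (upd k z.2 (c z.1)) * \1_(`[0, a]%classic : set R) z.2)%:E.
rewrite [X in measurable_fun _ X](_ : _ = fubini_F mu h); last first.
  apply/funext => y; rewrite /fubini_F integral_mkcond/=.
  apply: eq_integral => x _; rewrite /h /= patchE indicE.
  by case: ifP => _; rewrite ?mulr1 ?mulr0.
apply: measurable_fun_fubini_tonelli_F => [|z].
  apply/measurable_EFinP/measurable_funM.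
    apply: mF => j; rewrite /upd; case: (j == k); first exact: measurable_snd.
    exact: (measurableT_comp (mc j) measurable_fst).
  have mI : measurable_fun setT (\1_(`[0, a]%classic : set R) : measurableTypeR R -> R).
    exact: measurable_indic.
  exact: (measurableT_comp mI measurable_snd).
rewrite lee_fin mulr_ge0//; by case/andP: (bF (upd k z.2 (c z.1))).
Qed.

(** The same iterated integral as [box_avg], but still a function of [q]: the coordinates from [k]
    on stay free, which suits induction on [k]. *)
Fixpoint iter_avg (k : nat) F : (nat -> R) -> R :=
  if k is k'.+1 then coord_avg k' (iter_avg k' F) else F.

Lemma upd_comm k l (x y : R) q : k != l -> upd k x (upd l y q) = upd l y (upd k x q).
Proof.
move=> kl; apply/funext => j; rewrite /upd.
by case: eqP => // ->; rewrite (negbTE kl).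
Qed.

Lemma iter_avg_upd k l (x : R) F q : (k <= l)%N ->
  iter_avg k (fun q => F (upd l x q)) q = iter_avg k F (upd l x q).
Proof.
elim: k q => [//|k IH] q kl /=; rewrite /coord_avg; congr (_ * _).
apply: eq_Rintegral => y _; rewrite IH 1?ltnW//.
by rewrite upd_comm// gtn_eqF.
Qed.

Lemma box_avgE k F : box_avg a k F = iter_avg k F (fun=> 0).
Proof.
elim: k F => [//|k IH] F /=; rewrite /coord_avg; congr (_ * _).
by apply: eq_Rintegral => x _; rewrite IH -iter_avg_upd.
Qed.

Lemma nice_iter_avg (B : R) k F : nice B F -> nice B (iter_avg k F).
Proof. by move=> nF; elim: k => // k IH; exact: nice_coord_avg. Qed.

(** The comparison is asked only inside the box, so that the bound [q i <= a] on perturbations can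
    be used pointwise. *)
Lemma iter_avg_le (B1 B2 : R) k F G q : nice B1 F -> nice B2 G ->
  (forall q', (forall j, (j < k)%N -> 0 <= q' j <= a) ->
     (forall j, (k <= j)%N -> q' j = q j) -> F q' <= G q') ->
  iter_avg k F q <= iter_avg k G q.
Proof.
move=> nF nG; elim: k q => [|k IH] q FG /=; first by apply: FG.
apply: coord_avg_le; [exact: nice_iter_avg nF|exact: nice_iter_avg nG|].
move=> x xa; apply: IH => q' q'a q'q; apply: FG => j jk.
  move: jk; rewrite ltnS leq_eqVlt => /predU1P[->|]; last exact: q'a.
  by rewrite q'q// /upd eqxx.
by rewrite q'q 1?ltnW// /upd gtn_eqF.
Qed.

Lemma iter_avg_cst k (x : R) q : iter_avg k (fun=> x) q = x.
Proof.
elim: k q => // k IH q /=; rewrite -[RHS](coord_avg_cst k x q).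
by congr coord_avg; apply/funext.
Qed.

Lemma iter_avgD (B1 B2 : R) k F G q : nice B1 F -> nice B2 G ->
  iter_avg k (fun q => F q + G q) q = iter_avg k F q + iter_avg k G q.
Proof.
move=> nF nG; elim: k q => // k IH q /=.
have -> : iter_avg k (fun q => F q + G q) = fun q => iter_avg k F q + iter_avg k G q.
  exact/funext.
by apply: (coord_avgD (B1 := B1) (B2 := B2)); exact: nice_iter_avg.
Qed.

Lemma iter_avgZ (B x : R) k F q : nice B F ->
  iter_avg k (fun q => x * F q) q = x * iter_avg k F q.
Proof.
move=> nF; elim: k q => // k IH q /=.
have -> : iter_avg k (fun q => x * F q) = fun q => x * iter_avg k F q.
  exact/funext.
by apply: (coord_avgZ (B := B)); exact: nice_iter_avg.
Qed.

Lemma iter_avg_sum (I : Type) (s : seq I) (B : R) k (F : I -> (nat -> R) -> R) q :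
  (forall i, nice B (F i)) ->
  iter_avg k (fun q => \sum_(i <- s) F i q) q = \sum_(i <- s) iter_avg k (F i) q.
Proof.
move=> nF; elim: s => [|i s IH].
  rewrite big_nil -[RHS](iter_avg_cst k 0 q); congr iter_avg.
  by apply/funext => ?; rewrite big_nil.
rewrite big_cons -IH -(iter_avgD _ _ (nF i) (nice_sum s nF)); congr iter_avg.
by apply/funext => ?; rewrite big_cons.
Qed.

Definition shift (j : nat) (d : R) q : nat -> R := fun i => q i + (i == j)%:R * d.

Lemma coord_measurable_shift j d F : coord_measurable F ->
  coord_measurable (fun q => F (shift j d q)).
Proof.
move=> mF d' Y c mc; apply: mF => i; rewrite /shift.
by apply: measurable_funD.
Qed.

Lemma nice_shift (B d : R) j F : nice B F -> nice B (fun q => F (shift j d q)).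
Proof. by move=> [mF bF]; split=> [|q //]; exact: coord_measurable_shift. Qed.

Lemma iter_avg_shift_ge (d : R) k j F q : (k <= j)%N ->
  iter_avg k (fun q => F (shift j d q)) q = iter_avg k F (shift j d q).
Proof.
elim: k q => // k IH q kj /=; rewrite /coord_avg; congr (_ * _).
apply: eq_Rintegral => x _; rewrite IH 1?ltnW//; congr iter_avg.
apply/funext => i; rewrite /shift /upd; case: eqP => // ->.
by rewrite ltn_eqF// mul0r addr0.
Qed.

(** The stability estimate. Only the integral over coordinate [j] sees the shift: its window moves
    by [d], which gains at most [d * B], divided by [a] on averaging. Later averages are monotone
    and fix constants, so they keep the bound. *)
Lemma iter_avg_shift (B d : R) k j F q : 0 <= d -> nice B F -> (j < k)%N ->
  iter_avg k (fun q => F (shift j d q)) q <= iter_avg k F q + d * B / a.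
Proof.
move=> d0 nF; elim: k q => // k IH q; rewrite ltnS leq_eqVlt => /predU1P[->|jk] /=.
  have nFk := nice_iter_avg k nF; have [mF bF] := nice_upd k q nFk.
  rewrite /coord_avg mulrC -[d * B / a]mulrC -mulrDr mulrC ler_pM2l ?invr_gt0//.
  apply: le_trans (Rintegral_translate_le (ltW a0) d0 mF bF).
  rewrite le_eqVlt; apply/orP; left; apply/eqP; apply: eq_Rintegral => x _.
  rewrite iter_avg_shift_ge//; congr iter_avg; apply/funext => i.
  by rewrite /shift /upd; case: eqP => _; rewrite ?mul1r// mul0r addr0.
have B0 : 0 <= B by have [_ b] := nF; have := b (fun=> 0); lra.
have n1 : nice (d * B / a) (fun=> d * B / a).
  by apply: nice_cst; rewrite lexx !mulr_ge0// invr_ge0 ltW.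
rewrite -[X in _ <= _ + X](coord_avg_cst k _ q).
rewrite -(coord_avgD k q (nice_iter_avg k nF) n1).
apply: coord_avg_le; first by apply: nice_iter_avg; exact: nice_shift nF.
  by apply: niceD; [exact: nice_iter_avg nF|exact: n1].
by move=> x _; exact: IH.
Qed.

End BoxAverage.

(** * Ranking weights and the minimising permutation *)

Section RankWeights.
Context {R : realType}.

(** Discount of the 0-based rank [k]: the rank counted from 1 is [k + 1], and the logarithm takes
    one more. *)
Definition weight (k : nat) : R := (log2 (k.+2)%:R)^-1.

Lemma ln2_gt0 : 0 < ln 2 :> R.
Proof. by rewrite ln_gt0// ltr1n. Qed.

Lemma log2_ge1 k : 1 <= @log2 R k.+2%:R.
Proof.
rewrite /log2 ler_pdivlMr ?ln2_gt0// mul1r ler_ln ?posrE ?ltr0n//.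
by rewrite ler_nat.
Qed.

Lemma weight_gt0 k : 0 < weight k.
Proof. by rewrite invr_gt0 (lt_le_trans ltr01)// log2_ge1. Qed.

Lemma weight_ge0 k : 0 <= weight k. Proof. exact/ltW/weight_gt0. Qed.

Lemma weight_le1 k : weight k <= 1.
Proof. by rewrite invf_le1 ?log2_ge1// (lt_le_trans ltr01)// log2_ge1. Qed.

Lemma weight_anti k l : (k <= l)%N -> weight l <= weight k.
Proof.
move=> kl; rewrite lef_pV2 ?posrE ?(lt_le_trans ltr01 (log2_ge1 _))//.
rewrite /log2 ler_pM2r ?invr_gt0 ?ln2_gt0// ler_ln ?posrE ?ltr0n//.
by rewrite ler_nat !ltnS.
Qed.

Definition wsum (m : nat) (s : 'S_m) (v : 'I_m -> R) : R :=
  \sum_(i < m) weight (s i) * v i.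

Lemma DCG_wsum m (s : 'S_m) r : DCG R s r = wsum s (fun i => 2 ^+ r i - 1).
Proof. by apply: eq_bigr => i _; rewrite mulrC. Qed.

Lemma argmin_perm_min m (v : 'I_m -> R) (s : 'S_m) :
  score (argmin_perm v) v <= score s v.
Proof.
rewrite /argmin_perm; case: pickP => [t /forallP /(_ s)//|none].
(* Finitely many permutations have a minimiser, so the default of [argmin_perm] is never
   returned. *)
case: (arg_minP (fun s => score s v) (i0 := 1%g : 'S_m) (P := predT)) => // t _ tmin.
have /negP[] := negbT (none t).
by apply/forallP => t'; exact: tmin.
Qed.

Lemma score_tperm m (s : 'S_m) (v : 'I_m -> R) i j : i != j ->
  score (tperm i j * s)%g v = score s v + ((s j)%:R - (s i)%:R) * (v i - v j).
Proof.
move=> ij; rewrite /score (bigD1 i)//= (bigD1 j) 1?eq_sym//=.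
rewrite [in RHS](bigD1 i)//= [in RHS](bigD1 j) 1?eq_sym//=.
rewrite !permM tpermL tpermR.
under eq_bigr => k /andP[ki kj].
  rewrite permM tpermD; [|by rewrite eq_sym|by rewrite eq_sym].
  over.
rewrite -!natr1; ring.
Qed.

(** Exchange argument: swapping the ranks of [i] and [j] must not lower the score, which fixes the
    sign of [s j - s i]. *)
Lemma argmin_perm_sorts m (v : 'I_m -> R) i j :
  v i < v j -> (argmin_perm v j < argmin_perm v i)%N.
Proof.
move=> vij; set s := argmin_perm v.
have ij : i != j by apply: contraTneq vij => ->; rewrite ltxx.
have := argmin_perm_min v (tperm i j * s)%g; rewrite -/s score_tperm// lerDl.
rewrite nmulr_lge0 ?subr_lt0// subr_le0 ler_nat leq_eqVlt => /predU1P[|//].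
by move=> /val_inj/perm_inj ji; rewrite ji eqxx in ij.
Qed.

(** Abel summation: a weight becomes a nonnegative combination of indicators of being ranked at most
    [l]. *)
Lemma weight_telescope m k : (k <= m)%N ->
  weight k = weight m + \sum_(l < m | (k <= l)%N) (weight l - weight l.+1).
Proof.
move=> km; rewrite -(big_mkord (fun l => k <= l)%N (fun l => weight l - weight l.+1)).
rewrite (big_cat_nat (n := k))//= big_nat_cond big1 ?add0r; last first.
  by move=> l /andP[/andP[_ lk]]; rewrite leqNgt lk.
rewrite big_nat_cond (eq_bigl (fun l => k <= l < m)%N); last first.
  by move=> l /=; case: (k <= l)%N; rewrite ?andbF ?andbT.
rewrite -big_nat (telescope_sumr_eq (fun l => - weight l))//; first by ring.
by move=> l _; ring.
Qed.

(* Summation by parts on the ranks: it is enough to compare, for each [l], the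
   total value of the [l.+1] top-ranked objects. *)
Lemma rearrangement m (s t : 'S_m) (v : 'I_m -> R) :
  (forall i j, v i < v j -> (s j < s i)%N) -> wsum t v <= wsum s v.
Proof.
move=> sorted.
have wE (u : 'S_m) : wsum u v = weight m * (\sum_i v i) +
    \sum_(l < m) (weight l - weight l.+1) * \sum_i (u i <= l)%N%:R * v i.
  rewrite /wsum mulr_sumr.
  under [X in _ + X]eq_bigr => l _ do rewrite mulr_sumr.
  rewrite exchange_big -big_split/=; apply: eq_bigr => i _.
  rewrite (@weight_telescope m (u i)) 1?ltnW// mulrDl; congr (_ + _).
  rewrite big_mkcond mulr_suml; apply: eq_bigr => l _.
  by case: ifP => _; rewrite ?mul1r// ?mul0r mulr0.
rewrite !wE lerD2l; apply: ler_sum => l _.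
rewrite ler_wpM2l ?subr_ge0 ?weight_anti//.
(* [c] is a threshold: [s] ranks at most [l] only values [>= c], and beyond [l] only values [<= c].
   Every permutation ranks equally many objects at most [l], so [v] may be replaced by [v - c],
   after which [s] wins term by term. *)
pose c := v (s^-1%g l).
have cardE (u : 'S_m) : \sum_i (u i <= l)%N%:R = \sum_(i < m) (i <= l)%N%:R :> R.
  by rewrite [RHS](reindex_inj (@perm_inj _ u)).
have splitE (u : 'S_m) : \sum_i (u i <= l)%N%:R * v i =
    \sum_i (u i <= l)%N%:R * (v i - c) + (\sum_(i < m) (i <= l)%N%:R) * c.
  rewrite -(cardE u) mulr_suml -big_split/=; apply: eq_bigr => i _; ring.
rewrite !splitE lerD2r; apply: ler_sum => i _.
case: (leqP (s i) l) => sl; rewrite ?mul1r ?mul0r.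
  have : c <= v i.
    rewrite leNgt; apply/negP => /sorted; rewrite permKV => h.
    by have := leq_trans h sl; rewrite ltnn.
  by move=> ?; case: (t i <= l)%N; rewrite ?mul1r ?mul0r ?subr_ge0.
have : v i <= c.
  rewrite leNgt; apply/negP => /sorted; rewrite permKV => h.
  by have := ltn_trans h sl; rewrite ltnn.
by move=> ?; case: (t i <= l)%N; rewrite ?mul1r ?mul0r ?subr_le0.
Qed.

Lemma argmin_perm_max m (v : 'I_m -> R) (s : 'S_m) :
  wsum s v <= wsum (argmin_perm v) v.
Proof. by apply: rearrangement => i j; exact: argmin_perm_sorts. Qed.

Lemma wsumD m (s : 'S_m) (u v : 'I_m -> R) :
  wsum s (fun i => u i + v i) = wsum s u + wsum s v.
Proof. by rewrite -big_split; apply: eq_bigr => i _; rewrite mulrDr. Qed.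

Lemma wsum_ge0 m (s : 'S_m) (v : 'I_m -> R) : (forall i, 0 <= v i) -> 0 <= wsum s v.
Proof. by move=> v0; apply: sumr_ge0 => i _; rewrite mulr_ge0// weight_ge0. Qed.

Lemma wsum_le m (s : 'S_m) (v : 'I_m -> R) B :
  (forall i, 0 <= v i <= B) -> wsum s v <= m%:R * B.
Proof.
move=> vB; rewrite -[X in _ <= X%:R * _]card_ord -sumr_const mulr_suml.
apply: ler_sum => i _; have /andP[v0 vb] := vB i.
by rewrite ler_pM// ?weight_ge0 ?weight_le1.
Qed.

(* [argmin_perm] factors through the finite table of comparisons of scores. *)
Lemma coord_measurable_argmin m (u : 'I_m -> R) (phi : 'S_m -> R) :
  coord_measurable (fun q => phi (argmin_perm (fun i => u i + q i))).
Proof.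
move=> d Y c mc.
pose tab y : {ffun 'S_m * 'S_m -> bool} :=
  [ffun st => score st.1 (fun i => u i + c y i) <= score st.2 (fun i => u i + c y i)].
pose sel (b : {ffun 'S_m * 'S_m -> bool}) : 'S_m :=
  odflt 1%g [pick s | [forall t, b (s, t)]].
have selE y : phi (argmin_perm (fun i => u i + c y i)) =
    \sum_b phi (sel b) * (tab y == b)%:R.
  rewrite (bigD1 (tab y))//= eqxx mulr1 big1 ?addr0; last first.
    by move=> b; rewrite eq_sym => /negbTE ->; rewrite mulr0.
  congr phi; rewrite /argmin_perm /sel; congr odflt; apply: eq_pick => s.
  by apply: eq_forallb => t; rewrite ffunE.
rewrite (funext selE); apply: measurable_sum => b.
apply: measurable_funM => //.
have mscore (s : 'S_m) : measurable_fun setT (fun y => score s (fun i => u i + c y i)).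
  apply: measurable_sum => i; apply: measurable_funM => //.
  exact: measurable_funD.
(* Equality of tables is a product over their entries, each a measurable comparison of two
   scores. *)
have -> : (fun y => (tab y == b)%:R) = (fun y => \prod_st (tab y st == b st)%:R) :> (Y -> R).
  apply/funext => y; case: eqP => [->|/eqP].
    by rewrite big1// => st _; rewrite eqxx.
  move=> /eqP tb; have /existsP[st st_neq] : [exists st, tab y st != b st].
    apply: contra_notT tb; rewrite negb_exists => /forallP h.
    by apply/ffunP => st; apply/eqP; move: (h st); rewrite negbK.
  by rewrite (bigD1 st)//= (negbTE st_neq) mul0r.
apply: measurable_prod => st _.
have mle : measurable_fun setT (fun y => score st.1 (fun i => u i + c y i) <=
                           score st.2 (fun i => u i + c y i)).
  exact: measurable_fun_ler.
rewrite [X in measurable_fun _ X](_ : _ = fun y => if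
    score st.1 (fun i => u i + c y i) <= score st.2 (fun i => u i + c y i)
    then (true == b st)%:R else (false == b st)%:R); last first.
  by apply/funext => y; rewrite ffunE; case: ifP.
exact: measurable_fun_ifT.
Qed.

End RankWeights.

(** * Follow the perturbed leader *)

Section FollowThePerturbedLeader.
Context {R : realType}.
Variables (m : nat) (a : R).
Hypothesis a0 : 0 < a.
Implicit Types (s v : 'I_m -> R) (j : 'I_m).

Definition leader_weight s j (q : nat -> R) : R :=
  weight (argmin_perm (fun i => s i + q i) j).

(** The expected gain of the perturbed leader is linear in the gain vector with these coefficients,
    so stability need only be shown for them. *)
Definition mean_weight s j : R := box_avg a m (leader_weight s j).

Lemma nice_leader_weight s j : nice 1 (leader_weight s j).
Proof.
split=> [|q]; last by rewrite weight_ge0 weight_le1.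
exact: (coord_measurable_argmin s (fun t : 'S_m => weight (t j))).
Qed.

Lemma mean_weight_bounds s j : 0 <= mean_weight s j <= 1.
Proof.
rewrite /mean_weight box_avgE.
by have [_] := nice_iter_avg a0 m (nice_leader_weight s j); apply.
Qed.

Lemma iter_avg_wsum s v : (forall j, 0 <= v j) ->
  iter_avg a m (fun q => wsum (argmin_perm (fun i => s i + q i)) v) (fun=> 0) =
  \sum_j mean_weight s j * v j.
Proof.
move=> v0; pose B := \sum_j v j.
have vB j : v j <= B by rewrite /B (bigD1 j)//= lerDl sumr_ge0.
pose F j q := v j * leader_weight s j q.
have nF j : nice B (F j).
  have [mF bF] := niceZ (v0 j) (nice_leader_weight s j).
  split=> // q; have /andP[F0 F1] := bF q; rewrite F0 (le_trans F1)// mulr1//.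
have -> : (fun q : nat -> R => wsum (argmin_perm (fun i => s i + q i)) v) =
    (fun q => \sum_j F j q).
  by apply/funext => q; apply: eq_bigr => j _; rewrite mulrC.
rewrite (iter_avg_sum a0 _ _ _ nF); apply: eq_bigr => j _.
by rewrite (iter_avgZ a0 _ _ _ (nice_leader_weight s j)) /mean_weight box_avgE mulrC.
Qed.

Lemma nice_wsum s v : (forall j, 0 <= v j) ->
  nice (\sum_j v j) (fun q => wsum (argmin_perm (fun i => s i + q i)) v).
Proof.
move=> v0; split=> [|q]; last first.
  rewrite wsum_ge0//=; apply: ler_sum => j _.
  by rewrite ler_piMl// weight_le1.
exact: (coord_measurable_argmin s (fun t : 'S_m => wsum t v)).
Qed.

(** Moving [s i] by [v i] is the same as shifting the perturbation in coordinate [i]. Doing this one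
    coordinate at a time costs [v i / a] each, weights being at most 1. *)
Lemma mean_weight_shift s v j : (forall i, 0 <= v i) ->
  mean_weight (fun i => s i + v i) j <= mean_weight s j + (\sum_i v i) / a.
Proof.
move=> v0; pose s_ n i := s i + (i < n)%N%:R * v i.
suff H n : (n <= m)%N ->
    mean_weight (s_ n) j <= mean_weight s j + (\sum_(i < m | (i < n)%N) v i) / a.
  have := H m (leqnn m).
  have -> : s_ m = fun i => s i + v i.
    by apply/funext => i; rewrite /s_ ltn_ord mul1r.
  by rewrite (eq_bigl predT)// => i; rewrite ltn_ord.
elim: n => [_|n IH nm].
  rewrite big_pred0// mul0r addr0.
  by have -> : s_ 0%N = s by apply/funext => i; rewrite /s_ mul0r addr0.
pose i0 := Ordinal nm.
have -> : \sum_(i < m | (i < n.+1)%N) v i = \sum_(i < m | (i < n)%N) v i + v i0.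
  rewrite (bigD1 i0)//= addrC; congr (_ + _); apply: eq_bigl => i.
  by rewrite ltnS [RHS]ltn_neqAle -val_eqE /= andbC.
rewrite mulrDl addrA; apply: le_trans (lerD (IH (ltnW nm)) (lexx _)).
rewrite /mean_weight !box_avgE.
have -> : leader_weight (s_ n.+1) j = fun q => leader_weight (s_ n) j (shift n (v i0) q).
  apply/funext => q; rewrite /leader_weight; congr (weight (argmin_perm _ j)).
  apply/funext => i; rewrite /s_ /shift ltnS leq_eqVlt.
  have [ein|_] := eqVneq (i : nat) n; last by rewrite /= mul0r; ring.
  have -> : i = i0 by exact/val_inj.
  by rewrite /= ltnn !mul1r mul0r; ring.
rewrite -[X in _ + X / a]mulr1.
exact: (iter_avg_shift a0 _ (v0 i0) (nice_leader_weight (s_ n) j)).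
Qed.

Variables (rho : nat -> 'I_m -> R) (B : R).
Hypothesis rhoB : forall n i, 0 <= rho n i <= B.

Definition cum n i : R := \sum_(n' < n) rho n' i.

Lemma cumS n i : cum n.+1 i = cum n i + rho n i.
Proof. by rewrite /cum big_ord_recr. Qed.

(** Induction on [n]: the newest leader is, on the older cumulative vector, no better than the older
    leader. *)
Lemma be_the_leader (q : nat -> R) n :
  wsum (argmin_perm (fun i => cum n i + q i)) (fun i => cum n i + q i) <=
  wsum (argmin_perm (fun i => cum 0 i + q i)) (fun i => q i) +
  \sum_(n' < n) wsum (argmin_perm (fun i => cum n'.+1 i + q i)) (rho n').
Proof.
elim: n => [|n IH].
  rewrite big_ord0 addr0 le_eqVlt; apply/orP; left; apply/eqP.
  by apply: eq_bigr => i _; rewrite {2}/cum big_ord0 add0r.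
set M := argmin_perm (fun i => cum n.+1 i + q i).
have -> : wsum M (fun i => cum n.+1 i + q i) =
    wsum M (fun i => cum n i + q i) + wsum M (rho n).
  by rewrite -wsumD; apply: eq_bigr => i _; rewrite cumS; ring.
rewrite big_ord_recr/= addrA lerD2r; apply: le_trans IH.
exact: argmin_perm_max.
Qed.

Lemma fpl_regret (s : 'S_m) K :
  \sum_(n < K) wsum s (rho n) <=
  \sum_(n < K) \sum_j mean_weight (cum n) j * rho n j +
  m%:R * a + K%:R * ((m%:R * B) ^+ 2 / a).
Proof.
have rho0 n i : 0 <= rho n i by case/andP: (rhoB n i).
have rho_sum n : 0 <= \sum_i rho n i <= m%:R * B.
  rewrite sumr_ge0//= -[X in _ <= X%:R * _]card_ord -sumr_const mulr_suml.
  by apply: ler_sum => i _; rewrite mul1r; case/andP: (rhoB n i).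
pose c0 := \sum_(n < K) wsum s (rho n).
pose G n (q : nat -> R) := wsum (argmin_perm (fun i => cum n.+1 i + q i)) (rho n).
have nG n : nice (\sum_(j < m) B) (G n).
  have [mG bG] := nice_wsum (cum n.+1) (rho0 n).
  split=> // q; have /andP[G0 G1] := bG q; rewrite G0 (le_trans G1)//.
  by apply: ler_sum => i _; case/andP: (rhoB n i).
(* Be-the-leader holds for each fixed perturbation and is then averaged over the box; the initial
   term is at most [m * a] there. *)
have btl : c0 <= \sum_(n < K) \sum_j mean_weight (cum n.+1) j * rho n j + m%:R * a.
  have c00 : 0 <= c0 by apply: sumr_ge0 => n _; exact: wsum_ge0.
  have ma0 : 0 <= m%:R * a by rewrite mulr_ge0// ltW.
  have -> : \sum_(n < K) \sum_j mean_weight (cum n.+1) j * rho n j =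
      iter_avg a m (fun q => \sum_(n < K) G n q) (fun=> 0).
    rewrite (iter_avg_sum a0 _ _ _ (fun n : 'I_K => nG n)).
    by apply: eq_bigr => n _; rewrite iter_avg_wsum.
  rewrite -[c0](iter_avg_cst a0 m _ (fun=> 0)).
  rewrite -[X in _ + X](iter_avg_cst a0 m _ (fun=> 0)).
  have nc (x : R) : 0 <= x -> nice x (fun=> x).
    by move=> x0; apply: nice_cst; rewrite x0 lexx.
  have nS := nice_sum (index_enum 'I_K) (fun n : 'I_K => nG n).
  rewrite -(iter_avgD a0 m _ nS (nc _ ma0)).
  apply: (iter_avg_le a0 (nc _ c00) (niceD nS (nc _ ma0))) => q qa _.
  have qi0 (i : 'I_m) : 0 <= q i <= a by exact: qa.
  (* Adding the nonnegative perturbation on the left makes [s] comparable with the perturbed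
     leader. *)
  apply: (@le_trans _ _ (wsum s (fun i => cum K i + q i))).
    rewrite wsumD -[c0]addr0 lerD//; last by apply: wsum_ge0 => i; case/andP: (qi0 i).
    rewrite /c0 /wsum exchange_big le_eqVlt; apply/orP; left; apply/eqP.
    by apply: eq_bigr => i _; rewrite /cum mulr_sumr.
  apply: le_trans (argmin_perm_max _ s) _.
  apply: le_trans (be_the_leader q K) _.
  by rewrite addrC lerD2l; exact: wsum_le.
apply: le_trans btl _.
rewrite -addrA [m%:R * a + _]addrC addrA lerD2r.
rewrite mulr_natl -[X in _ *+ X]card_ord -sumr_const -big_split/=.
apply: ler_sum => n _.
(* Using the current leader instead of the next one changes each weight by at most [m B / a], and
   [rho n] has total mass at most [m B]. *)
apply: (@le_trans _ _ (\sum_j (mean_weight (cum n) j * rho n j + (m%:R * B / a) * rho n j))).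
  apply: ler_sum => j _; rewrite -mulrDl ler_wpM2r//.
  have -> : cum n.+1 = fun i => cum n i + rho n i by apply/funext => i; exact: cumS.
  apply: le_trans (mean_weight_shift _ _ (rho0 n)) _.
  by rewrite lerD2l ler_pM2r ?invr_gt0//; case/andP: (rho_sum n).
rewrite big_split/= lerD2l -mulr_sumr.
have /andP[h0 h1] := rho_sum n.
rewrite expr2 mulrAC ler_pM2r ?invr_gt0// ler_wpM2l// (le_trans h0 h1)//.
Qed.

End FollowThePerturbedLeader.

Lemma fpl_gainE (R : realType) m (eps : R) (s : 'I_m -> R) (rt : 'I_m -> nat) :
  0 < eps -> fpl_gain eps s rt = \sum_j mean_weight eps^-1 s j * (2 ^+ rt j - 1).
Proof.
move=> e0; rewrite /fpl_gain box_avgE -iter_avg_wsum ?invr_gt0//; last first.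
  by move=> j; rewrite subr_ge0 exprn_ege1// ler1n.
by congr iter_avg; apply/funext => q; rewrite DCG_wsum.
Qed.

(** * Blocks and exploration *)

Section BlockReduction.
Context {R : realType}.

(** Addition in ['I_L.+1] is modular, so this is a cyclic rotation of the exploration points of
    block [i]; it preserves injectivity. *)
Definition rot_choice m K L (i : 'I_K) (c : 'I_L.+1) (E : expl_choice m K L.+1) :
  expl_choice m K L.+1 :=
  [ffun i' => if i' == i then [ffun j => E i j + c] else E i'].

Lemma rot_choiceK m K L i c : cancel (@rot_choice m K L i c) (rot_choice i (- c)).
Proof.
move=> E; apply/ffunP => i'; rewrite !ffunE eqxx.
by case: eqP => // ->; apply/ffunP => j; rewrite !ffunE addrK.
Qed.

Lemma valid_rot_choice m K L i c (E : expl_choice m K L.+1) :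
  valid_choice E -> valid_choice (rot_choice i c E).
Proof.
move=> /forallP vE; apply/forallP => i'; rewrite ffunE; case: eqP => // _.
apply/injectiveP => j j'; rewrite !ffunE => /addIr.
exact: (injectiveP _ (vE i)).
Qed.

Lemma valid_rot_choiceE m K L i c (E : expl_choice m K L.+1) :
  valid_choice (rot_choice i c E) = valid_choice E.
Proof.
apply/idP/idP; last exact: valid_rot_choice.
by move=> /(valid_rot_choice i (- c)); rewrite rot_choiceK.
Qed.

(* Rotating the exploration points of block [i] preserves the uniform law, and
   averaging over the rotations makes each of them uniform in the block. *)
Lemma sample_unbiased m K L (i : 'I_K) (j : 'I_m) (Phi : expl_choice m K L -> R)
    (h : 'I_L -> R) :
  (forall E E' : expl_choice m K L, (forall i', i' != i -> E i' = E' i') -> Phi E = Phi E') ->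
  L%:R * \sum_(E : expl_choice m K L | valid_choice E) Phi E * h (E i j) =
  \sum_(E : expl_choice m K L | valid_choice E) Phi E * \sum_o h o.
Proof.
(* Rotations need a nonempty block; for [L = 0] both sides vanish. *)
case: L Phi h => [|L] Phi h PhiP.
  by rewrite mul0r big1// => E _; rewrite big_ord0 mulr0.
(* The factor [L] becomes a sum over rotations, each copy being reindexed by its own; [Phi] does not
   see block [i]. *)
rewrite mulr_natl -[X in _ *+ X]card_ord -sumr_const.
transitivity (\sum_(c < L.+1) \sum_(E : expl_choice m K L.+1 | valid_choice E)
    Phi E * h (E i j + c)).
  apply: eq_bigr => c _.
  rewrite (reindex (rot_choice i c)); last first.
    exists (rot_choice i (- c)) => E _; first exact: rot_choiceK.
    by have := rot_choiceK i (- c) E; rewrite opprK.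
  apply: eq_big => [E|E _]; first exact: valid_rot_choiceE.
  rewrite !ffunE eqxx !ffunE; congr (_ * _); apply: PhiP => i' /negbTE i'i.
  by rewrite ffunE i'i.
rewrite exchange_big; apply: eq_bigr => E _; rewrite -mulr_sumr; congr (_ * _).
by rewrite [RHS](reindex_inj (addrI (E i j))).
Qed.

Lemma card_valid_gt0 m K L : (m <= L)%N ->
  (0 < #|[set E : expl_choice m K L | valid_choice E]|)%N.
Proof.
move=> mL; apply/card_gt0P; exists [ffun=> [ffun j => widen_ord mL j]].
rewrite inE; apply/forallP => i; apply/injectiveP => j j'.
by rewrite !ffunE => /(congr1 val)/= /val_inj.
Qed.

Lemma gain_ge0 k : 0 <= 2 ^+ k - 1 :> R.
Proof. by rewrite subr_ge0 exprn_ege1// ler1n. Qed.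

Lemma gain_le k n : (k <= n)%N -> 2 ^+ k - 1 <= 2 ^+ n - 1 :> R.
Proof. by move=> kn; rewrite lerD2r ler_weXn2l// ler1n. Qed.

(** The estimate used in a block depends on earlier blocks only; this is the independence behind
    unbiasedness. *)
Lemma shat_indep m K L (r : nat -> 'I_m -> nat) (E E' : expl_choice m K L) i :
  (forall i', i' != i -> E i' = E' i') -> shat R r E i = shat R r E' i.
Proof.
move=> EE'; apply/funext => j; apply: eq_bigr => i' i'i; rewrite EE'//.
by apply: contraTneq i'i => ->; rewrite ltnn.
Qed.

(** * Regret of the block algorithm, summed over exploration choices *)

Section Analysis.
Variables (m n K L : nat) (r : nat -> 'I_m -> nat) (eps : R).
Hypothesis e0 : 0 < eps.
Hypothesis rn : forall t j, (r t j <= n)%N.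
Let B : R := 2 ^+ n - 1.
Let g t j : R := 2 ^+ r t j - 1.

Let gB t j : 0 <= g t j <= B.
Proof. by rewrite gain_ge0 gain_le. Qed.

Lemma fpl_gain_bounds s t : 0 <= fpl_gain eps s (r t) <= m%:R * B.
Proof.
have w01 j : 0 <= mean_weight eps^-1 s j <= 1.
  by apply: mean_weight_bounds; rewrite invr_gt0.
rewrite fpl_gainE//; apply/andP; split.
  by apply: sumr_ge0 => j _; rewrite mulr_ge0 ?gain_ge0//; case/andP: (w01 j).
rewrite -[X in _ <= X%:R * _]card_ord -sumr_const mulr_suml; apply: ler_sum => j _.
have /andP[w0 w1] := w01 j; have /andP[g0 g1] := gB t j.
exact: ler_pM.
Qed.

Lemma fpl_block_regret (s : 'S_m) (E : expl_choice m K L) :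
  \sum_(i < K) wsum s (fun j => g (i * L + E i j) j) <=
  \sum_(i < K) \sum_j mean_weight eps^-1 (shat R r E i) j * g (i * L + E i j) j +
  (m%:R / eps + K%:R * ((m%:R * B) ^+ 2 * eps)).
Proof.
case: K E => [|K'] E.
  rewrite !big_ord0 mul0r addr0 add0r mulr_ge0// invr_ge0 ltW//.
(* For fixed [E] the sampled vectors are an input sequence for the perturbed leader; [inord] extends
   it to all of [nat], and only indices below [K] matter. *)
pose rho k j := g (k * L + E (inord k) j) j.
have := @fpl_regret R m eps^-1 _ rho B _ s K'.+1.
rewrite invr_gt0 invrK => /(_ e0 (fun k i => gB _ i)) H.
rewrite [leLHS](eq_bigr (fun i : 'I_K'.+1 => wsum s (rho i))); last first.
  by move=> i _; apply: eq_bigr => j _; rewrite /rho inord_val.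
apply: le_trans H _; rewrite -addrA lerD2r le_eqVlt; apply/orP; left; apply/eqP.
apply: eq_bigr => i _; apply: eq_bigr => j _; rewrite /rho inord_val.
congr (mean_weight _ _ j * _); apply/funext => k; rewrite /cum /shat.
rewrite (big_ord_widen K'.+1 (fun i' => rho i' k)) 1?ltnW//.
by apply: eq_bigr => i' _; rewrite /rho inord_val.
Qed.

(** An exploration round gains at least 0 where the perturbed leader gains at most [m B]. The
    indicator sum marks these rounds and totals [m] over a block. *)
Lemma round_gain_ge expl (E : expl_choice m K L) i (o : 'I_L) :
  fpl_gain eps (shat R r E i) (r (i * L + o)%N) - m%:R * B * \sum_j (E i j == o)%:R <=
  round_gain eps r expl E i o.
Proof.
have /andP[f0 f1] := fpl_gain_bounds (shat R r E i) (i * L + o).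
have B0 : 0 <= m%:R * B by exact: le_trans f1.
have S0 : 0 <= \sum_j (E i j == o)%:R :> R by exact: sumr_ge0.
rewrite /round_gain; case: pickP => [j Ej|_]; last by rewrite gerBl mulr_ge0.
apply: (@le_trans _ _ 0); last by rewrite DCG_wsum wsum_ge0// => k; exact: gain_ge0.
rewrite subr_le0 (le_trans f1)// ler_peMr// (bigD1 j)//= Ej lerDl.
exact: sumr_ge0.
Qed.

(** Serves twice: with the mean weights of the perturbed leader, and with the constant weights of a
    fixed competitor. *)
Lemma block_unbiased (w : expl_choice m K L -> 'I_K -> 'I_m -> R) :
  (forall (E E' : expl_choice m K L) i j,
     (forall i', i' != i -> E i' = E' i') -> w E i j = w E' i j) ->
  \sum_(E : expl_choice m K L | valid_choice E) \sum_(i < K) \sum_(o < L)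
    \sum_j w E i j * g (i * L + o) j =
  L%:R * \sum_(E : expl_choice m K L | valid_choice E) \sum_(i < K)
    \sum_j w E i j * g (i * L + E i j) j.
Proof.
move=> wP; rewrite exchange_big [in RHS]exchange_big mulr_sumr /=.
apply: eq_bigr => i _; rewrite [in RHS]exchange_big mulr_sumr /=.
under eq_bigr => E _ do rewrite exchange_big/=.
rewrite exchange_big; apply: eq_bigr => j _ /=.
rewrite (@sample_unbiased m K L i j (fun E => w E i j) (fun o => g (i * L + o) j)).
  by apply: eq_bigr => E _; rewrite mulr_sumr.
by move=> E E' EE'; exact: wP.
Qed.

(** Regret on the sampled vectors is transferred to the true ones by [block_unbiased] on both sides.
    Sums over valid choices replace expectations, hence the factor in front. *)
Lemma total_gain_ge (s : 'S_m) expl :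
  (#|[set E : expl_choice m K L | valid_choice E]|)%:R *
    (\sum_(i < K) \sum_(o < L) DCG R s (r (i * L + o)%N)
     - (L%:R * (m%:R / eps + K%:R * ((m%:R * B) ^+ 2 * eps)) +
        K%:R * (m%:R * (m%:R * B)))) <=
  \sum_(E : expl_choice m K L | valid_choice E)
    \sum_(i < K) \sum_(o < L) round_gain eps r expl E i o.
Proof.
set N := #|_|; set c1 := m%:R / eps + _; set c2 := K%:R * _.
have NE (x : R) : N%:R * x = \sum_(E : expl_choice m K L | valid_choice E) x.
  rewrite mulr_natl -sumr_const; apply: eq_bigl => E.
  by apply/idP/idP => [/set_mem|] //; exact: mem_set.
(* Intermediate quantity: the perturbed leader plays every round, and [c2] pays for the exploration
   rounds. *)
apply: (@le_trans _ _ (\sum_(E : expl_choice m K L | valid_choice E)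
    (\sum_(i < K) \sum_(o < L) fpl_gain eps (shat R r E i) (r (i * L + o)%N) - c2))).
  rewrite sumrB -NE opprD addrA mulrBr lerD2r [leLHS]mulrBr.
  pose V (E : expl_choice m K L) :=
    \sum_(i < K) \sum_j mean_weight eps^-1 (shat R r E i) j * g (i * L + E i j) j.
  have -> : \sum_(E : expl_choice m K L | valid_choice E)
      \sum_(i < K) \sum_(o < L) fpl_gain eps (shat R r E i) (r (i * L + o)%N) =
      L%:R * \sum_(E : expl_choice m K L | valid_choice E) V E.
    rewrite -block_unbiased; last by move=> E E' i j /(shat_indep r) ->.
    by do 3!apply: eq_bigr => ? _; rewrite fpl_gainE.
  have -> : N%:R * (\sum_(i < K) \sum_(o < L) DCG R s (r (i * L + o)%N)) =
      L%:R * \sum_(E : expl_choice m K L | valid_choice E)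
               \sum_(i < K) wsum s (fun j => g (i * L + E i j) j).
    rewrite -(@block_unbiased (fun _ _ j => weight (s j)))// NE.
    by do 3!apply: eq_bigr => ? _; rewrite DCG_wsum.
  rewrite lerBlDr mulrCA -mulrDr ler_wpM2l// NE -big_split/=.
  by apply: ler_sum => E _; exact: fpl_block_regret.
apply: ler_sum => E _; rewrite lerBlDr /c2.
have -> : K%:R * (m%:R * (m%:R * B)) =
    \sum_(i < K) \sum_(o < L) m%:R * B * \sum_j (E i j == o)%:R.
  rewrite mulr_natl -[X in _ *+ X]card_ord -sumr_const; apply: eq_bigr => i _.
  rewrite -mulr_sumr exchange_big/= [m%:R * (_ * _)]mulrC; congr (_ * _).
  rewrite (eq_bigr (fun=> 1)); first by rewrite sumr_const card_ord.
  move=> j _; rewrite (bigD1 (E i j))//= eqxx big1 ?addr0// => o.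
  by rewrite eq_sym => /negbTE ->.
rewrite -big_split/=; apply: ler_sum => i _; rewrite -big_split/=.
by apply: ler_sum => o _; rewrite -lerBlDr; exact: round_gain_ge.
Qed.

End Analysis.
End BlockReduction.

(** * Upper bound for the prescribed [K] and [eps] *)

Lemma sum_blocks (V : nmodType) K L (F : nat -> V) :
  \sum_(t < K * L) F t = \sum_(i < K) \sum_(o < L) F (i * L + o)%N.
Proof.
elim: K => [|K IH]; first by rewrite mul0n !big_ord0.
by rewrite big_ord_recr/= mulSnr big_split_ord/= IH.
Qed.

Lemma powR_cbrtE (R : realType) (x : R) k : 0 <= x ->
  x `^ (k%:R / 3) = (x `^ (1 / 3)) ^+ k.
Proof.
by move=> x0; rewrite -powR_mulrn ?powR_ge0// -powRrM; congr (_ `^ _); rewrite mul1r mulrC.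
Qed.

Lemma rtop1f_regret (R : realType) (m n T K : nat) (r : nat -> 'I_m -> nat)
    (expl : nat -> 'I_m -> 'S_m) (eps : R) :
  (1 <= m)%N -> (1 <= n)%N -> (0 < K)%N -> (K %| T)%N -> (m <= T %/ K)%N ->
  (K%:R : R) = m%:R `^ (- (1/3)) * T%:R `^ (2/3) ->
  (forall t j, (r t j <= n)%N) ->
  eps = Num.sqrt (1 / ((2 ^+ n - 1) ^+ 2 * m%:R * K%:R)) ->
  best_cumDCG R T r - rtop1f_expected_gain T K eps r expl
    <= 3 * (2 ^+ n - 1) * m%:R `^ (5/3) * T%:R `^ (2/3).
Proof.
move=> m1 n1 K0 KT mL KE rn eps_def; set L := (T %/ K)%N in mL.
have TE : T = (K * L)%N by rewrite mulnC divnK.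
have L0 : (0 < L)%N by exact: leq_trans mL.
have T0 : (0 < T)%N by rewrite TE muln_gt0 K0.
pose B : R := 2 ^+ n - 1.
have B0 : 0 < B by rewrite subr_gt0 exprn_egt1 ?ltr1n// -lt0n.
pose a : R := m%:R `^ (1 / 3); pose b : R := T%:R `^ (1 / 3).
have a0 : 0 < a by rewrite powR_gt0// ltr0n.
have b0 : 0 < b by rewrite powR_gt0// ltr0n.
have mE : m%:R = a ^+ 3.
  by rewrite -powR_cbrtE// divff ?pnatr_eq0// powRr1.
have TE3 : T%:R = b ^+ 3.
  by rewrite -powR_cbrtE// divff ?pnatr_eq0// powRr1.
have KE' : K%:R = b ^+ 2 / a by rewrite KE powRN mulrC powR_cbrtE.
have LE : L%:R = a * b.
  have h : b ^+ 3 = b ^+ 2 / a * L%:R by rewrite -TE3 {1}TE natrM KE'.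
  have c0 : b ^+ 2 / a != 0 by rewrite lt0r_neq0// divr_gt0// exprn_gt0.
  by apply: (mulfI c0); rewrite -h; field; rewrite lt0r_neq0.
have epsE : eps = (B * (a * b))^-1.
  rewrite eps_def KE' mE -/B.
  have -> : 1 / (B ^+ 2 * a ^+ 3 * (b ^+ 2 / a)) = ((B * (a * b))^-1) ^+ 2.
    by field; rewrite !lt0r_neq0.
  by rewrite sqrtr_sqr ger0_norm// invr_ge0 ltW// !mulr_gt0.
have eps0 : 0 < eps by rewrite epsE invr_gt0 !mulr_gt0.
(* The three terms coincide for these parameters, whence the constant 3. *)
have -> : 3 * (2 ^+ n - 1) * m%:R `^ (5 / 3) * T%:R `^ (2 / 3) =
    L%:R * (m%:R / eps + K%:R * ((m%:R * B) ^+ 2 * eps)) + K%:R * (m%:R * (m%:R * B)).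
  rewrite !powR_cbrtE// -/a -/b -/B epsE KE' LE mE.
  by field; rewrite !lt0r_neq0.
set bnd := (X in _ <= X).
suff H s : cumDCG R T r s <= bnd + rtop1f_expected_gain T K eps r expl.
  by rewrite lerBlDr; apply: bigmax_le.
have := @total_gain_ge R m n K L r eps eps0 rn s expl.
rewrite -/bnd -lerBlDl /rtop1f_expected_gain -/L ler_pdivlMr; last first.
  by rewrite ltr0n card_valid_gt0.
rewrite mulrC; suff -> : cumDCG R T r s =
  \sum_(i < K) \sum_(o < L) DCG R s (r (i * L + o)%N) by [].
by rewrite -(sum_blocks K L (fun t => DCG R s (r t))) -TE.
Qed.

(** * Lower bound for top-1 feedback *)

Section LowerBound.
Context {R : realType}.
Implicit Types (s : 'S_3) (x : bool) (l : seq bool).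

Let o0 : 'I_3 := @Ordinal 3 0 isT.
Let o1 : 'I_3 := @Ordinal 3 1 isT.
Let o2 : 'I_3 := @Ordinal 3 2 isT.

Lemma weight0 : weight 0 = 1 :> R.
Proof. by rewrite /weight /log2 divff ?invr1// gt_eqF// ln2_gt0. Qed.

Lemma weight2 : weight 2 = 2^-1 :> R.
Proof.
rewrite /weight /log2; congr _^-1.
have -> : 4 = 2 ^+ 2 :> R by rewrite expr2 -natrM.
by rewrite lnXn// mulr2n; field; rewrite gt_eqF// ln2_gt0.
Qed.

(** This weight is [ln 2 / ln 3]; the bounds are [3 < 2 ^ 2] and [2 ^ 3 < 3 ^ 2]. The lower one
    makes the gap [d] positive, the upper one makes exploration costly. *)
Lemma weight1_bounds : 2^-1 < @weight R 1 < 2 / 3.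
Proof.
have l2 := @ln2_gt0 R.
have lt2 : ln 3 < 2 * ln 2 :> R.
  rewrite mulr_natl -lnXn// ltr_ln ?posrE ?exprn_gt0// expr2 -natrM ltr_nat//.
have gt32 : 3 * ln 2 < 2 * ln 3 :> R.
  rewrite !mulr_natl -!lnXn// ltr_ln ?posrE ?exprn_gt0// -!natrX ltr_nat//.
have l3 : 0 < ln 3 :> R by lra.
rewrite /weight /log2 invf_div; apply/andP; split.
  by rewrite ltr_pdivlMr//; lra.
by rewrite ltr_pdivrMr//; lra.
Qed.

Definition bit_relevance x (j : 'I_3) : nat :=
  if val j is k.+1 then (if k == 0%N then x else ~~ x) else 1%N.

Definition seq_relevance l (t : nat) : 'I_3 -> nat := bit_relevance (nth false l t).

Lemma DCG_bit s x : DCG R s (bit_relevance x) =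
  weight (s o0) + (if x then weight (s o1) else weight (s o2)).
Proof.
rewrite DCG_wsum /wsum !big_ord_recl big_ord0.
have -> : lift ord0 ord0 = o1 by exact: val_inj.
have -> : lift ord0 (lift ord0 ord0) = o2 by exact: val_inj.
have -> : ord0 = o0 by exact: val_inj.
by rewrite /bit_relevance /=; case: x => /=; rewrite expr1 expr0; ring.
Qed.

(** Expected one-round regret of [s] against [c] when the bit is true with probability [p]. *)
Definition loss (c s : 'S_3) (p : R) : R :=
  p * (DCG R c (bit_relevance true) - DCG R s (bit_relevance true)) +
  (1 - p) * (DCG R c (bit_relevance false) - DCG R s (bit_relevance false)).

Lemma perm3_cases s : [\/ [/\ s o0 = o0, s o1 = o1 & s o2 = o2],
  [/\ s o0 = o0, s o1 = o2 & s o2 = o1], [/\ s o0 = o1, s o1 = o0 & s o2 = o2] |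
  [\/ [/\ s o0 = o1, s o1 = o2 & s o2 = o0], [/\ s o0 = o2, s o1 = o0 & s o2 = o1] |
      [/\ s o0 = o2, s o1 = o1 & s o2 = o0]]].
Proof.
have o3 (i : 'I_3) : [\/ i = o0, i = o1 | i = o2].
  by case: i => -[|[|[|//]]] ?; [constructor 1|constructor 2|constructor 3]; exact: val_inj.
have n01 : s o0 != s o1 by rewrite (inj_eq perm_inj).
have n02 : s o0 != s o2 by rewrite (inj_eq perm_inj).
have n12 : s o1 != s o2 by rewrite (inj_eq perm_inj).
case: (o3 (s o0)) => e0; case: (o3 (s o1)) => e1; case: (o3 (s o2)) => e2;
  rewrite ?e0 ?e1 ?e2 ?eqxx// in n01 n02 n12 *;
  by [constructor 1|constructor 2|constructor 3|constructor 4; constructor 1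
     |constructor 4; constructor 2|constructor 4; constructor 3].
Qed.

(** * Potential argument for the two biases *)

Section Potential.
Variable e : R.
Hypotheses (e0 : 0 < e) (e4 : e <= 4^-1).
Let d : R := weight 1 - 2^-1.
Let c2 : 'S_3 := tperm o1 o2.

(** Each of the two rankings with object 0 first is optimal for one bias and loses [2 e d] under the
    other; [a b / (a + b)] is below both [a] and [b]. *)
Lemma loss_top s (a b : R) : 0 < a -> 0 < b -> s o0 = o0 ->
  2 * e * d * (a * b / (a + b)) <= a * loss 1%g s (2^-1 + e) + b * loss c2 s (2^-1 - e).
Proof.
move=> a0 b0 s0; have /andP[w1 w1'] := weight1_bounds.
have ab0 : 0 < a + b by exact: addr_gt0.
have ha : a * b / (a + b) <= a.
  by rewrite ler_pdivrMr// ler_pM2l// lerDr ltW.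
have hb : a * b / (a + b) <= b.
  by rewrite ler_pdivrMr// mulrC ler_pM2l// lerDl ltW.
have ed0 : 0 < 2 * e * d by rewrite !mulr_gt0 ?subr_gt0.
rewrite /loss !DCG_bit !perm1 tpermL tpermR tpermD// s0.
have [[_ -> ->]|[_ -> ->]|[]|[[]|[]|[]]] := perm3_cases s; rewrite ?s0// weight2 /=.
- apply: le_trans (_ : 2 * e * d * b <= _); first by rewrite ler_pM2l.
  by rewrite /d le_eqVlt; apply/orP; left; apply/eqP; field.
- apply: le_trans (_ : 2 * e * d * a <= _); first by rewrite ler_pM2l.
  by rewrite /d le_eqVlt; apply/orP; left; apply/eqP; field.
Qed.

(** The cheapest such ranking swaps object 0 with the likelier of the other two. It loses
    [(2^-1 - e) * (1 - weight 1)], at least [1/4 * 1/3]. *)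
Lemma loss_explore s (a b : R) : 0 < a -> 0 < b -> s o0 != o0 ->
  (a + b) / 12 <= a * loss 1%g s (2^-1 + e) + b * loss c2 s (2^-1 - e).
Proof.
move=> a0 b0 s0; have /andP[w1 w1'] := weight1_bounds.
suff [h1 h2] : 12^-1 <= loss 1%g s (2^-1 + e) /\ 12^-1 <= loss c2 s (2^-1 - e).
  by rewrite mulrDl lerD// ler_pM2l.
(* These products supply [lra] with the mixed term [e * weight 1]. *)
have f1 : 0 <= e * (2 / 3 - weight 1) by rewrite mulr_ge0 ?subr_ge0 ?ltW.
have f2 : 0 <= e * (weight 1 - 2^-1) by rewrite mulr_ge0 ?subr_ge0 ?ltW.
have f3 : 0 <= (4^-1 - e) * (2 / 3 - weight 1) by rewrite mulr_ge0 ?subr_ge0 // ltW.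
have f4 : 0 <= (4^-1 - e) * (weight 1 - 2^-1) by rewrite mulr_ge0 ?subr_ge0 // ltW.
rewrite /loss !DCG_bit !perm1 tpermL tpermR tpermD//.
have [[E _ _]|[E _ _]|[-> -> ->]|[[-> -> ->]|[-> -> ->]|[-> -> ->]]] := perm3_cases s;
  rewrite ?E ?eqxx// in s0 *; rewrite weight2 weight0 /=; split; lra.
Qed.

(* [a b / (a + b)] bounds both posterior weights from below, and one observation
   of the hidden bit shrinks it on average by at most the factor [1 - 4 e ^ 2]. *)
Lemma harmonic_split (a b : R) : 0 < a -> 0 < b ->
  (1 - 4 * e ^+ 2) * (a * b / (a + b)) <=
  (a * (2^-1 + e)) * (b * (2^-1 - e)) / (a * (2^-1 + e) + b * (2^-1 - e)) +
  (a * (2^-1 - e)) * (b * (2^-1 + e)) / (a * (2^-1 - e) + b * (2^-1 + e)).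
Proof.
move=> a0 b0.
have p0 : 0 < 2^-1 + e by move: (e0); lra.
have q0 : 0 < 2^-1 - e by move: (e4); lra.
set u := a * (2^-1 + e) + _; set v := a * (2^-1 - e) + _.
have u0 : 0 < u by rewrite addr_gt0// mulr_gt0.
have v0 : 0 < v by rewrite addr_gt0// mulr_gt0.
have ab0 : 0 < a + b by exact: addr_gt0.
have -> : a * (2^-1 + e) * (b * (2^-1 - e)) / u + a * (2^-1 - e) * (b * (2^-1 + e)) / v
    = a * b * (4^-1 - e ^+ 2) * (a + b) / (u * v).
  have <- : u + v = a + b by rewrite /u /v; field.
  by field; rewrite !lt0r_neq0.
have -> : (1 - 4 * e ^+ 2) * (a * b / (a + b)) =
    a * b * (4^-1 - e ^+ 2) * (a + b) / ((a + b) ^+ 2 / 4).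
  by field; rewrite lt0r_neq0.
have r0 : 0 <= a * b * (4^-1 - e ^+ 2) * (a + b).
  have -> : 4^-1 - e ^+ 2 = (2^-1 + e) * (2^-1 - e) by field.
  by rewrite !mulr_ge0// ltW.
rewrite ler_wpM2l// lef_pV2 ?posrE ?mulr_gt0 ?exprn_gt0 ?invr_gt0//.
have -> : u * v = (a + b) ^+ 2 / 4 - (e * (a - b)) ^+ 2 by rewrite /u /v; field.
by rewrite gerBl sqr_ge0.
Qed.

Variables (L : learner R 3) (HL : is_learner L).

Definition feedback s x : nat := top1_feedback s (bit_relevance x) ord0.

Lemma feedback_top s x : s o0 = o0 -> feedback s x = 1%N.
Proof.
move=> s0; rewrite /feedback /top1_feedback.
suff -> : (s^-1)%g ord0 = o0 by [].
by apply: (@perm_inj _ s); rewrite permKV s0; exact: val_inj.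
Qed.

(** Time enters only through the relevances, so the remaining game can restart at time 0 on the
    shifted sequence. *)
Lemma learner_valueS (r : nat -> 'I_3 -> nat) k t h :
  learner_value L r k t.+1 h = learner_value L (fun u => r u.+1) k t h.
Proof.
by elim: k t h => //= k IH t h; apply: eq_bigr => s _; rewrite IH.
Qed.

Definition regret (c : 'S_3) k l h : R :=
  \sum_(t < k) DCG R c (seq_relevance l t) - learner_value L (seq_relevance l) k 0 h.

Lemma regretS c k x l h : regret c k.+1 (x :: l) h =
  \sum_s L h s * (DCG R c (bit_relevance x) - DCG R s (bit_relevance x) +
    regret c k l (rcons h (s, feedback s x))).
Proof.
have [_ L1] := HL h.
rewrite /regret big_ord_recl /= -[X in X - _]mul1r -L1 mulr_suml -sumrB.
apply: eq_bigr => s _; rewrite -mulrBr learner_valueS; congr (_ * _).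
by rewrite /seq_relevance /=; ring.
Qed.

(** Expectation over [k] independent bits, each true with probability [p]. *)
Fixpoint bit_avg (p : R) k (F : seq bool -> R) : R :=
  if k is k'.+1 then
    p * bit_avg p k' (fun l => F (true :: l)) +
    (1 - p) * bit_avg p k' (fun l => F (false :: l))
  else F [::].

Lemma eq_bit_avg p k F G : F =1 G -> bit_avg p k F = bit_avg p k G.
Proof. by move=> /funext ->. Qed.

Lemma bit_avg_sum p k (u v : 'S_3 -> R) (F : 'S_3 -> seq bool -> R) :
  bit_avg p k (fun l => \sum_s u s * (v s + F s l)) =
  \sum_s u s * (v s + bit_avg p k (F s)).
Proof.
elim: k F => // k IH F /=; rewrite !IH !mulr_sumr -big_split/=.
by apply: eq_bigr => s _; ring.
Qed.

(** Probabilistic method: this turns the random bits into an oblivious adversary. *)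
Lemma bit_avg_exists p k F : 0 <= p <= 1 -> exists l, bit_avg p k F <= F l.
Proof.
move=> /andP[p0 p1]; elim: k F => [|k IH] F /=; first by exists [::].
have [l1 h1] := IH (fun l => F (true :: l)); have [l2 h2] := IH (fun l => F (false :: l)).
have [h|h] := leP (F (true :: l1)) (F (false :: l2)).
  by exists (false :: l2); nra.
by exists (true :: l1); nra.
Qed.

Definition mean_regret c p k h := bit_avg p k (fun l => regret c k l h).

(** The ranking is chosen before the bit, so the round contributes [loss], and the bit reaches the
    future only through the feedback. *)
Lemma mean_regretS c p k h : mean_regret c p k.+1 h =
  \sum_s L h s * (loss c s p +
    (p * mean_regret c p k (rcons h (s, feedback s true)) +
     (1 - p) * mean_regret c p k (rcons h (s, feedback s false)))).
Proof.
rewrite /mean_regret /= !(eq_bit_avg _ _ (fun l => regretS _ _ _ l _)).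
rewrite !bit_avg_sum !mulr_sumr -big_split/=.
by apply: eq_bigr => s _; rewrite /loss; ring.
Qed.

Lemma mean_regret_ge k h (a b : R) : 0 < a -> 0 < b -> k%:R * e ^+ 3 <= 16^-1 ->
  2 * e * d * k%:R * (a * b / (a + b)) <=
  a * mean_regret 1%g (2^-1 + e) k h + b * mean_regret c2 (2^-1 - e) k h.
Proof.
have /andP[w1 w1'] := weight1_bounds.
have d0 : 0 < d by rewrite subr_gt0.
have d6 : d <= 6^-1 by rewrite /d; lra.
elim: k h a b => [|k IH] h a b a0 b0 ke.
  by rewrite mulr0 mul0r /mean_regret /= /regret !big_ord0 !subr0 !mulr0 addr0.
have ke' : k%:R * e ^+ 3 <= 16^-1.
  by apply: le_trans ke; rewrite ler_pM2r ?exprn_gt0// ler_nat.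
have [L0 L1] := HL h.
rewrite !mean_regretS !mulr_sumr -big_split/=.
(* The probabilities [L h s] sum to 1, so it suffices to prove the bound for each ranking [s]. *)
have LE (x : R) : x = \sum_s L h s * x by rewrite -mulr_suml L1 mul1r.
rewrite [leLHS]LE; apply: ler_sum => s _.
rewrite ![a * (L h s * _)]mulrCA ![b * (L h s * _)]mulrCA -mulrDr ler_wpM2l//.
set psi := a * b / (a + b).
have kS : k.+1%:R = k%:R + 1 :> R by rewrite natr1.
have [s0|s0] := eqVneq (s o0) o0.
  (* Both bits give the same feedback, so the histories agree and the likelihoods [a], [b] do not
     change. *)
  rewrite !feedback_top//; have i1 := IH (rcons h (s, 1%N)) _ _ a0 b0 ke'.
  have l0 := loss_top a0 b0 s0; rewrite -/psi in i1 l0.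
  by rewrite kS; move: i1 l0; lra.
have l1 := loss_explore a0 b0 s0.
have p0 : 0 < 2^-1 + e by move: (e0); lra.
have q0 : 0 < 2^-1 - e by move: (e4); lra.
(* After an exploring ranking the likelihoods are multiplied by the probability of the bit under
   each bias. *)
have h1 := IH (rcons h (s, feedback s true)) _ _ (mulr_gt0 a0 p0) (mulr_gt0 b0 q0) ke'.
have h2 := IH (rcons h (s, feedback s false)) _ _ (mulr_gt0 a0 q0) (mulr_gt0 b0 p0) ke'.
have h3 := harmonic_split a0 b0.
have psi4 : psi <= (a + b) / 4.
  rewrite /psi ler_pdivrMr ?addr_gt0//; have := sqr_ge0 (a - b); nra.
have psi0 : 0 <= psi by rewrite divr_ge0 ?mulr_ge0 ?addr_ge0 ?ltW.
have ed0 : 0 <= 2 * e * d * k%:R by rewrite !mulr_ge0// ltW.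
have h4 := ler_wpM2l ed0 h3.
have ab0 : 0 < a + b by exact: addr_gt0.
have ed : e * d <= 24^-1.
  by apply: (@le_trans _ _ (4^-1 * 6^-1)); [rewrite ler_pM// ltW|lra].
(* The exploration loss [(a + b) / 12] must cover this round's increment [k1] and the drop of the
   potential [k2]; each is at most [(a + b) / 48]. *)
have k1 : 2 * e * d * psi <= (a + b) / 48.
  apply: (@le_trans _ _ (2 * e * d * ((a + b) / 4))); last by nra.
  by rewrite ler_wpM2l// !mulr_ge0// ltW.
have k2 : 8 * (k%:R * e ^+ 3) * d * psi <= (a + b) / 48.
  have ke0 : 0 <= k%:R * e ^+ 3 by rewrite mulr_ge0// exprn_ge0// ltW.
  have ked : (k%:R * e ^+ 3) * d <= 16^-1 * 6^-1 by rewrite ler_pM// ltW.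
  apply: (@le_trans _ _ (8 * (k%:R * e ^+ 3) * d * ((a + b) / 4))); last by nra.
  by rewrite ler_wpM2l// !mulr_ge0// ltW.
have h5 : 2 * e * d * k%:R * ((1 - 4 * e ^+ 2) * psi) =
    2 * e * d * k%:R * psi - 8 * (k%:R * e ^+ 3) * d * psi by ring.
have p0E : 1 - (2^-1 + e) = 2^-1 - e by field.
have q0E : 1 - (2^-1 - e) = 2^-1 + e by field.
rewrite p0E q0E kS; rewrite -/psi h5 in h4.
move: h1 h2 h4 l1 k1 k2 ab0; clear h3 h5 psi4 psi0.
(* Abstracting the nonlinear terms leaves a linear goal. *)
set X := _ / (a * (2^-1 + e) + _); set Y := _ / (a * (2^-1 - e) + _).
move: X Y psi (loss _ _ _) (loss _ _ _).
set Vp := mean_regret _ _ _ _; set Vq := mean_regret _ _ _ _.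
set Wp := mean_regret _ _ _ _; set Wq := mean_regret _ _ _ _.
move: Vp Vq Wp Wq => Vp Vq Wp Wq X Y psi l2 l3.
lra.
Qed.

End Potential.
End LowerBound.

Lemma top1_lower_bound (R : realType) : exists c : R, 0 < c /\ exists T0 : nat,
  forall (T : nat) (L : learner R 3), (T0 <= T)%N -> is_learner L ->
    exists r : nat -> 'I_3 -> nat, (forall t j, (r t j <= 1)%N) /\
      c * T%:R `^ (2/3) <= best_cumDCG R T r - learner_expected_gain T L r.
Proof.
have /andP[w1 _] := @weight1_bounds R.
pose d : R := weight 1 - 2^-1; have d0 : 0 < d by rewrite subr_gt0.
(* With [a = b = 1] the potential is [e d T = d T^(2/3) / 4], and one of the two biases gets at
   least half. *)
exists (d / 8); split; first by rewrite divr_gt0.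
exists 1%N => T L T1 HL.
pose b : R := T%:R `^ (1 / 3).
have T0 : 0 < T%:R :> R by rewrite ltr0n.
have b0 : 0 < b by rewrite powR_gt0.
have TE : T%:R = b ^+ 3 by rewrite -powR_cbrtE ?divff ?pnatr_eq0// ?powRr1// ltW.
have b1 : 1 <= b.
  rewrite leNgt; apply/negP => blt1.
  have : b ^+ 3 < 1 by rewrite exprn_ilt1// ltW.
  by rewrite -TE ltNge ler1n T1.
(* This choice gives both [e <= 1/4] and [T e^3 = 1/64]. *)
pose e : R := (4 * b)^-1.
have e0 : 0 < e by rewrite invr_gt0 mulr_gt0.
have e4 : e <= 4^-1 by rewrite lef_pV2 ?posrE ?mulr_gt0// ler_peMr.
have Te : T%:R * e ^+ 3 <= 16^-1.
  have -> : T%:R * e ^+ 3 = 64^-1 by rewrite TE /e; field; rewrite lt0r_neq0.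
  lra.
have := mean_regret_ge e0 e4 HL [::] ltr01 ltr01 Te.
rewrite !mul1r -/d; set V1 := mean_regret _ _ _ _ _; set V2 := mean_regret _ _ _ _ _ => V12.
have VT : d / 8 * T%:R `^ (2 / 3) <= V1 \/ d / 8 * T%:R `^ (2 / 3) <= V2.
  suff : 2 * (d / 8 * T%:R `^ (2 / 3)) <= V1 + V2.
    by case: (leP (d / 8 * T%:R `^ (2 / 3)) V1) => ? ?; [left|right; lra].
  apply: le_trans V12; rewrite (powR_cbrtE _ (ltW T0)) -/b TE /e le_eqVlt.
  by apply/orP; left; apply/eqP; field; rewrite lt0r_neq0.
suff H c p : 0 <= p <= 1 -> d / 8 * T%:R `^ (2 / 3) <= mean_regret L c p T [::] ->
    exists r : nat -> 'I_3 -> nat, (forall t j, (r t j <= 1)%N) /\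
      d / 8 * T%:R `^ (2/3) <= best_cumDCG R T r - learner_expected_gain T L r.
  by case: VT => /H; apply; lra.
move=> p01 hV; have [l hl] := bit_avg_exists T (fun l => regret L c T l [::]) p01.
exists (seq_relevance l); split.
  move=> t j; rewrite /seq_relevance /bit_relevance.
  by case: (val j) => // k; case: (k == 0%N); case: (nth _ _ _).
apply: le_trans hV _; apply: le_trans hl _; rewrite /regret lerD2r.
exact: (le_bigmax _ (cumDCG R T (seq_relevance l)) c).
Qed.

Theorem theorem4 (R : realType) :
  (* upper bound for RTop-1F *)
  (exists C : R, 0 < C /\
    forall (m n T K : nat) (r : nat -> 'I_m -> nat) (expl : nat -> 'I_m -> 'S_m),
      (1 <= m)%N -> (1 <= n)%N ->
      (0 < K)%N -> (K %| T)%N -> (m <= T %/ K)%N ->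
      (K%:R : R) = (m%:R : R) `^ (- (1/3)) * (T%:R : R) `^ (2/3) ->
      (forall t j, (r t j <= n)%N) ->
      (forall t j, expl t j j = 0%N :> nat) ->
      let eps : R := Num.sqrt (1 / (((2 : R) ^+ n - 1) ^+ 2 * m%:R * K%:R)) in
      best_cumDCG R T r - rtop1f_expected_gain T K eps r expl
        <= C * ((2 : R) ^+ n - 1) * (m%:R `^ (5/3)) * (T%:R `^ (2/3)))
  /\
  (* matching lower bound: m = 3, binary relevance *)
  (exists c : R, 0 < c /\ exists T0 : nat,
    forall (T : nat) (L : learner R 3), (T0 <= T)%N -> is_learner L ->
      exists r : nat -> 'I_3 -> nat, (forall t j, (r t j <= 1)%N) /\
        c * (T%:R `^ (2/3)) <= best_cumDCG R T r - learner_expected_gain T L r).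
Proof.
split; last exact: top1_lower_bound.
exists 3; split=> // m n T K r expl m1 n1 K0 KT mL KE rn _.
exact: rtop1f_regret.
Qed.
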